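(* In the angular-movement model, let $\kappa>0$ be fixed and suppose $\kappa\sqrt s\le(\pi-\phi(R))\sinh(\beta R)$. Let $\mathcal D^{(s)}(\kappa):=\{x_0=(r_0,\theta_0)\in B_O(R): |\theta_0|\le\phi(r_0)+\kappa\sqrt s\,e^{-\beta r_0}\}$ and $\overline{\mathcal D}^{(s)}(\kappa)=B_O(R)\setminus\mathcal D^{(s)}(\kappa)$. Then $\inf_{x_0\in\mathcal D^{(s)}(\kappa)}\mathbb P_{x_0}(T_{det}\le s)=\Omega(\Phi(-\kappa))$, $\sup_{x_0\in\overline{\mathcal D}^{(s)}(\kappa)}\mathbb P_{x_0}(T_{det}\le s)=O(\Phi(-\kappa))$, and $\int_{\overline{\mathcal D}^{(s)}(\kappa)}\mathbb P_{x_0}(T_{det}\le s)\,d\mu(x_0)=O(\mu(\mathcal D^{(s)}(\kappa)))$.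
   Context: Fixed constants $\nu>0$, $\alpha\in(\tfrac12,1]$, $\beta>0$; $R:=2\log(n/\nu)$. Hyperbolic plane in polar coordinates $(r,\theta)$, distance via $\cosh d_H=\cosh r\cosh r'-\sinh r\sinh r'\cos(\theta-\theta')$; $B_P(\rho)$ = points at distance $\le\rho$ from $P$. $\mu$ is the measure on $B_O(R)$ with $d\mu=n\frac{\alpha\sinh(\alpha r)}{2\pi(\cosh(\alpha R)-1)}dr\,d\theta$. Angular-movement model: a particle started at $x_0=(r_0,\theta_0)$ keeps radius $r_0$ and its angle is $\theta_0+B_{t/\sinh^2(\beta r_0)}$ with $B$ a standard Brownian motion (angles mod $2\pi$); $\mathbb P_{x_0}$ is its law and $T_{det}$ the first time it lies in $B_Q(R)$, $Q=(R,0)$. $\phi(r)\in[0,\pi/2]$ is defined by $\cos\phi(r)=\coth R\tanh(r/2)$ for $r\in[0,R]$. $\Phi$ is the standard normal distribution function. $s=s(n)\ge0$; asymptotics as $n\to\infty$. *)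

(* Defs.v *)
From HB Require Import structures.
From mathcomp Require Import all_boot all_order all_algebra.
From mathcomp Require Import all_classical all_reals all_analysis.
Set Implicit Arguments. Unset Strict Implicit. Unset Printing Implicit Defensive.
Import Order.TTheory GRing.Theory Num.Theory.
Import numFieldTopology.Exports numFieldNormedType.Exports.
Local Open Scope classical_set_scope.
Local Open Scope ring_scope.

Section Defs.
Context {R : realType}.

Definition sinh (x : R) : R := (expR x - expR (- x)) / 2.
Definition cosh (x : R) : R := (expR x + expR (- x)) / 2.
Definition tanh (x : R) : R := sinh x / cosh x.
Definition coth (x : R) : R := cosh x / sinh x.
Definition acosh (x : R) : R := ln (x + Num.sqrt (x ^+ 2 - 1)).

(* points of the hyperbolic plane in polar coordinates (r, theta) *)
Definition hdist (P X : R * R) : R :=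
  acosh (cosh P.1 * cosh X.1 - sinh P.1 * sinh X.1 * cos (P.2 - X.2)).

Definition hball (P : R * R) (rho : R) : set (R * R) :=
  [set X | hdist P X <= rho].

Definition Rad (nu : R) (n : nat) : R := 2 * ln (n%:R / nu).

Definition phi (Rd r : R) : R := acos (coth Rd * tanh (r / 2)).

Definition Phi (x : R) : R := fine (normal_prob 0 1 `]-oo, x]).

Definition diskO (Rd : R) : set (R * R) :=
  [set x | 0 <= x.1 <= Rd /\ - pi < x.2 <= pi].

Definition Dset (beta Rd s kappa : R) : set (R * R) :=
  [set x | diskO Rd x /\
     `|x.2| <= phi Rd x.1 + kappa * Num.sqrt s * expR (- (beta * x.1))].
Definition Dbar (beta Rd s kappa : R) : set (R * R) :=
  diskO Rd `\` Dset beta Rd s kappa.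

Definition mu_dens (nu alpha : R) (n : nat) (r : R) : R :=
  n%:R * (alpha * sinh (alpha * r))
    / (2 * pi * (cosh (alpha * Rad nu n) - 1)).

Definition mu_int (nu alpha : R) (n : nat) (f : R * R -> \bar R) : \bar R :=
  (\int[lebesgue_measure]_(r in [set` `[0%R, Rad nu n]%R])
     \int[lebesgue_measure]_(th in [set` `]- pi, pi]%R])
        (f (r, th) * (mu_dens nu alpha n r)%:E))%E.

Definition is_std_BM d (Omega : measurableType d) (P : probability Omega R)
    (B : R -> Omega -> R) : Prop :=
  [/\ forall t, measurable_fun setT (B t),
      forall w, B 0 w = 0,
      forall w, {within [set` `[0%R, +oo[%R], continuous (fun t : R => B t w)} &
      forall (k : nat) (t : nat -> R) (A : nat -> set R),
        t 0%N = 0 -> (forall i, t i < t i.+1) -> (forall i, measurable (A i)) ->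
        P (\bigcap_(i in [set i | (i < k)%N])
              [set w | A i (B (t i.+1) w - B (t i) w)])
        = (\prod_(i < k) normal_prob 0 (Num.sqrt (t i.+1 - t i)) (A i))%E].

Definition pos (beta : R) (B : R -> R) (x0 : R * R) (t : R) : R * R :=
  (x0.1, x0.2 + B (t / sinh (beta * x0.1) ^+ 2)).

Definition Tdet d (Omega : measurableType d) (beta Rd : R)
    (B : R -> Omega -> R) (x0 : R * R) (w : Omega) : \bar R :=
  ereal_inf [set t%:E | t in
    [set t : R | 0 <= t /\ hball (Rd, 0) Rd (pos beta (fun u => B u w) x0 t)]].

Definition Pdet d (Omega : measurableType d) (P : probability Omega R)
    (B : R -> Omega -> R) (beta Rd s : R) (x0 : R * R) : \bar R :=
  P [set w | (Tdet beta Rd B x0 w <= s%:E)%E].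

End Defs.

(* Main.v *)
Require Import Defs.
From HB Require Import structures.
From mathcomp Require Import all_boot all_order all_algebra.
From mathcomp Require Import all_classical all_reals all_analysis.
From mathcomp Require Import measurable_realfun.
From mathcomp Require Import ring lra.
Set Implicit Arguments. Unset Strict Implicit. Unset Printing Implicit Defensive.
Import Order.TTheory GRing.Theory Num.Theory.
Import numFieldTopology.Exports numFieldNormedType.Exports.
Local Open Scope classical_set_scope.
Local Open Scope ring_scope.

(** With [T = s / sinh (beta r)^2], the particle is detected before time [s] iff
    the Brownian path on [[0, T]] brings the angle within [phi r] of [0] modulo
    [2 pi].

    Lower bound: a point of [Dset] is at angular distance at most
    [kappa sqrt T] from the detection region, so it suffices that [B_T] overshoots
    this distance in the right direction (intermediate value theorem).

    Upper bound on the integral: detection from angular distance [x] forces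
    [max |B| >= x] on [[0, T]], of probability [O(T^2 / x^4)] by a chaining bound.
    The two sides are then compared radius by radius.  For [r <= 1 / beta] the
    section of [Dset] has angular width bounded below since [phi r] is.  For
    [r >= 1 / beta], writing [delta = kappa sqrt s exp (- beta r)], one has
    [T = O(delta^2)], so the detection probability integrates over [x >= delta]
    to [O(delta)], which the section of [Dset] dominates. *)

(** * Hyperbolic trigonometry and the detection angle *)

Section Hyperbolic.
Context {R : realType}.
Implicit Types x y r t a b rho Rd : R.

Lemma sinh0 : sinh (0 : R) = 0.
Proof. by rewrite /sinh oppr0 subrr mul0r. Qed.

Lemma sinh_gt0 x : 0 < x -> 0 < sinh x.
Proof. by move=> x0; rewrite divr_gt0// subr_gt0 ltr_expR; lra. Qed.

Lemma sinh_ge0 x : 0 <= x -> 0 <= sinh x.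
Proof. by move=> x0; rewrite divr_ge0// subr_ge0 ler_expR; lra. Qed.

Lemma cosh_gt0 x : 0 < cosh x.
Proof. by rewrite divr_gt0// addr_gt0// expR_gt0. Qed.

Lemma cosh_ge1 x : 1 <= cosh x.
Proof.
have e0 := expR_gt0 x; have : expR x * expR (- x) = 1 by rewrite expRxMexpNx_1.
have := expR_gt0 (- x); rewrite /cosh; move: (expR x) (expR (- x)) e0 => p q.
move=> p0 q0 pq; rewrite ler_pdivlMr// mul1r.
have := sqr_ge0 (p - 1); have := sqr_ge0 (q - 1); rewrite !expr2; nra.
Qed.

Lemma cosh2_sinh2 x : cosh x ^+ 2 = 1 + sinh x ^+ 2.
Proof.
have : expR x * expR (- x) = 1 by rewrite expRxMexpNx_1.
rewrite /cosh /sinh; move: (expR x) (expR (- x)) => p q pq.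
have : ((p + q) / 2) ^+ 2 - ((p - q) / 2) ^+ 2 = p * q by field.
by rewrite pq => /eqP; rewrite subr_eq => /eqP.
Qed.

Lemma sinhB a b : sinh (a - b) = sinh a * cosh b - cosh a * sinh b.
Proof. by rewrite /sinh /cosh opprB !expRD; field. Qed.

Lemma coshB a b : cosh (a - b) = cosh a * cosh b - sinh a * sinh b.
Proof. by rewrite /sinh /cosh opprB !expRD; field. Qed.

(** With [p = expR (r / 2)] and [q = expR (- (r / 2))], so that [p * q = 1], both sides equal
    [(p - q) ^+ 2 / 2]. This links the formula defining [phi] to the equation of the ball. *)
Lemma tanh_half r : sinh r * tanh (r / 2) = cosh r - 1.
Proof.
have e0 := expR_gt0 (r / 2).
have e0' := expR_gt0 (- (r / 2)).
have e1 : expR (r / 2) * expR (- (r / 2)) = 1 by rewrite expRxMexpNx_1.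
rewrite /tanh /sinh /cosh [in expR r](splitr r) [in expR (- r)](splitr r) opprD !expRD.
move: (expR (r / 2)) (expR (- (r / 2))) e0 e0' e1 => p q p0 q0 pq.
have ne : p + q != 0 by rewrite gt_eqF// addr_gt0.
have -> : (p * p - q * q) / 2 * ((p - q) / 2 / ((p + q) / 2)) = (p - q) ^+ 2 / 2.
  by field.
have -> : (p * p + q * q) / 2 - 1 = (p * p + q * q) / 2 - p * q by rewrite pq.
by field.
Qed.

Lemma tanh_ge0 x : 0 <= x -> 0 <= tanh x.
Proof. by move=> x0; rewrite divr_ge0 ?sinh_ge0// ltW// cosh_gt0. Qed.

Lemma ler_tanh a b : a <= b -> tanh a <= tanh b.
Proof.
move=> ab; rewrite /tanh ler_pdivrMr ?cosh_gt0// mulrAC ler_pdivlMr ?cosh_gt0//.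
by rewrite -subr_ge0 [X in _ - X]mulrC -sinhB sinh_ge0// subr_ge0.
Qed.

Lemma coth_anti a b : 0 < a -> a <= b -> coth b <= coth a.
Proof.
move=> a0 ab; have b0 := lt_le_trans a0 ab.
rewrite /coth ler_pdivrMr ?sinh_gt0// mulrAC ler_pdivlMr ?sinh_gt0//.
by rewrite -subr_ge0 [X in X - _]mulrC -sinhB sinh_ge0// subr_ge0.
Qed.

Lemma coth_tanh_half rho : 0 < rho ->
  coth rho * tanh (rho / 2) = cosh rho / (cosh rho + 1).
Proof.
move=> r0; have s0 := sinh_gt0 r0; have c0 := cosh_gt0 rho.
have := tanh_half rho; have := cosh2_sinh2 rho; rewrite /coth.
move: (tanh _) (sinh rho) (cosh rho) s0 c0 => t s c s0 c0 cs st.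
have -> : t = (c - 1) / s by rewrite -st mulrAC divff ?mul1r// gt_eqF.
have ss : s * s = (c - 1) * (c + 1) by move: cs; rewrite !expr2 => cs; lra.
have sne : s != 0 by rewrite gt_eqF.
have cne : c + 1 != 0 by rewrite gt_eqF// addr_gt0.
have c1 : c - 1 != 0.
  by apply/eqP => c1; move: ss; rewrite c1 mul0r => /eqP; rewrite mulf_eq0 orbb (negbTE sne).
have -> : c / s * ((c - 1) / s) = c * (c - 1) / (s * s) by field.
by rewrite ss; field; rewrite cne c1.
Qed.

(** [coth] decreases and [tanh] increases, so the extreme case is [Rd = r = rho]. The bound depends
    on [rho] alone and is below 1, which makes the estimates on [phi] uniform in [Rd]. *)
Lemma phi_arg Rd rho r : 0 < rho -> rho <= Rd -> 0 <= r <= rho ->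
  0 <= coth Rd * tanh (r / 2) <= cosh rho / (cosh rho + 1).
Proof.
move=> rho0 rhoR /andP[r0 rrho]; have R0 := lt_le_trans rho0 rhoR.
have cR : 0 <= coth Rd by rewrite divr_ge0 ?sinh_ge0// ltW// cosh_gt0.
have t0 : 0 <= tanh (r / 2) by apply: tanh_ge0; lra.
rewrite mulr_ge0//= -coth_tanh_half//.
apply: ler_pM => //; first exact: coth_anti.
by apply: ler_tanh; lra.
Qed.

Lemma cosh_ratio_lt1 rho : 0 < cosh rho / (cosh rho + 1) < 1.
Proof.
have c0 := cosh_gt0 rho; rewrite divr_gt0 ?addr_gt0//=.
by rewrite ltr_pdivrMr ?addr_gt0//; lra.
Qed.

Lemma phi_spec Rd r : 0 < Rd -> 0 <= r <= Rd ->
  [/\ 0 < phi Rd r, phi Rd r <= pi & cos (phi Rd r) = coth Rd * tanh (r / 2)].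
Proof.
move=> R0 rR; have /andP[p0 p1] := @phi_arg Rd Rd r R0 (lexx _) rR.
have /andP[_ q1] := cosh_ratio_lt1 Rd.
have p2 := le_lt_trans p1 q1; split.
- by apply: acos_gt0; lra.
- by apply: acos_lepi; lra.
- by apply: acosK; rewrite in_itv/=; lra.
Qed.

Lemma phi_lower rho : 0 < rho -> exists2 p0 : R, 0 < p0 < pi &
  forall Rd r, rho <= Rd -> 0 <= r <= rho -> p0 <= phi Rd r.
Proof.
move=> rho0; set q := cosh rho / (cosh rho + 1).
have /andP[q0 q1] := cosh_ratio_lt1 rho.
exists (acos q); first by rewrite acos_gt0 ?acos_ltpi//; rewrite /q; lra.
move=> Rd r rhoR rrho; have R0 := lt_le_trans rho0 rhoR.
have /andP[x0 x1] := phi_arg rho0 rhoR rrho.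
have rR : 0 <= r <= Rd by lra.
have [p0 p1 p2] := phi_spec R0 rR.
have q11 : -1 <= q <= 1 by rewrite /q; lra.
rewrite leNgt -ltr_cos ?in_itv/= ?acos_ge0 ?acos_lepi ?(ltW p0)//.
rewrite p2 acosK ?in_itv// -?leNgt// -/q.
all: by apply/andP; split; [lra|exact: le_trans x1 (ltW q1)].
Qed.

Lemma acosh_cosh x : 0 <= x -> acosh (cosh x) = x.
Proof.
move=> x0; rewrite /acosh cosh2_sinh2 (addrC 1) addrK sqrtr_sqr ger0_norm ?sinh_ge0//.
have -> : cosh x + sinh x = expR x by rewrite /cosh /sinh; field.
by rewrite expRK.
Qed.

Lemma ler_acosh x y : 1 <= x -> x <= y -> acosh x <= acosh y.
Proof.
move=> x1 xy; have s0 := @sqrtr_ge0 R.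
rewrite /acosh ler_ln ?posrE ?lerD ?ltr_pwDl//; try lra.
rewrite ler_sqrt; nra.
Qed.

Lemma ler_acoshE x y : 1 <= x -> 1 <= y -> (acosh x <= acosh y) = (x <= y).
Proof.
move=> x1 y1; apply/idP/idP; last exact: ler_acosh.
apply: contraTT; rewrite -!ltNge => yx; have s0 := @sqrtr_ge0 R.
rewrite /acosh ltr_ln ?posrE ?ltr_leD ?ltr_pwDl//; try lra.
by rewrite ler_sqrt; nra.
Qed.

(** [acosh] is known to be monotone only from 1 on; its argument here is at least [cosh (Rd - r)],
    hence at least 1. *)
Lemma hballE Rd r t : 0 < Rd -> 0 <= r ->
  hball (Rd, 0) Rd (r, t) <->
  cosh Rd * cosh r - sinh Rd * sinh r * cos t <= cosh Rd.
Proof.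
move=> R0 r0; rewrite /hball /hdist/= sub0r cosN -{3}(acosh_cosh (ltW R0)).
rewrite ler_acoshE ?cosh_ge1//.
apply: le_trans (cosh_ge1 (Rd - r)) _; rewrite coshB lerD2l lerN2.
by rewrite ler_piMr ?cos_le1// mulr_ge0// sinh_ge0// ltW.
Qed.

(** At [r = 0] the clock [t / sinh (beta * r) ^+ 2] degenerates; the centre is treated apart, as a
    point detected at time 0. *)
Lemma hball_center Rd t : 0 < Rd -> hball (Rd, 0) Rd (0, t).
Proof.
move=> R0; apply/hballE => //; rewrite sinh0 mulr0 mul0r subr0 /cosh.
by rewrite oppr0 expR0; lra.
Qed.

Lemma hball_phi Rd r t : 0 < Rd -> 0 < r <= Rd ->
  hball (Rd, 0) Rd (r, t) <-> cos (phi Rd r) <= cos t.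
Proof.
move=> R0 /andP[r0 rR]; have rR' : 0 <= r <= Rd by lra.
have [_ _ cp] := phi_spec R0 rR'; rewrite hballE ?(ltW r0)//.
have sr := sinh_gt0 r0; have sR := sinh_gt0 R0.
have key : sinh Rd * sinh r * cos (phi Rd r) = cosh Rd * (cosh r - 1).
  by rewrite -tanh_half cp /coth; field; rewrite gt_eqF.
have ss0 : 0 < sinh Rd * sinh r by rewrite mulr_gt0.
rewrite -[X in _ <-> is_true X](ler_pM2l ss0) key mulrBr mulr1.
by split; lra.
Qed.

Lemma sinh_lower x : 1 <= x -> expR x / 4 <= sinh x.
Proof.
move=> x1; have e1 := expR_ge1Dx x.
have e0 := expR_gt0 x; have : expR x * expR (- x) = 1 by rewrite expRxMexpNx_1.
rewrite /sinh; move: (expR x) (expR (- x)) e0 e1 => p q p0 p1 pq.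
(* Here [p >= 1 + x >= 2] and [p * q = 1]. *)
have : q <= 1 / 2 by nra.
lra.
Qed.

Lemma sinh_upper x : 2 * sinh x <= expR x.
Proof. by rewrite /sinh; have := expR_gt0 (- x); lra. Qed.

(* Angles are compared modulo [2 pi], and [cos] is not monotone past [pi]; the
   hypothesis [`|t| <= pi] makes the nearest boundary angle the one at distance
   [`|t| - p]. *)
Lemma cos_displacement p t b : 0 <= p -> p < `|t| -> `|t| <= pi ->
  cos p <= cos (t + b) -> `|t| - p <= `|b|.
Proof.
move=> p0 pt tpi.
wlog t0 : t b pt tpi / 0 <= t.
  move=> h; have [/h|t0] := leP 0 t; first exact.
  move=> h1; rewrite -normrN -[`|b|]normrN; apply: h; rewrite ?normrN//; first lra.
  by rewrite -opprD cosN.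
rewrite ger0_norm// in pt tpi *.
move=> h; rewrite leNgt; apply/negP; rewrite ltr_norml => /andP[b1 b2].
have [tb|tb] := leP (t + b) pi.
  have : p < t + b by lra.
  by rewrite -ltr_cos ?in_itv/=; lra.
(* Past [pi] the angle is reflected to [2 * pi - (t + b)], which still exceeds [p] because [t <= pi]
   and [b < t - p]. *)
have e : cos (t + b) = cos (2 * pi - (t + b)).
  have -> : 2 * pi - (t + b) = - (t + b) + pi + pi by ring.
  by rewrite !cosDpi opprK cosN.
rewrite e in h; have : p < 2 * pi - (t + b) by lra.
by rewrite -ltr_cos ?in_itv/=; lra.
Qed.

End Hyperbolic.

Lemma Rad_eventually (R : realType) (nu rho : R) : 0 < nu ->
  exists N : nat, forall n, (N <= n)%N -> rho <= Rad nu n.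
Proof.
move=> nu0; exists (Num.truncn (nu * expR (rho / 2))).+1 => n Nn.
have h : nu * expR (rho / 2) < n%:R.
  by apply: lt_le_trans (truncnS_gt _) _; rewrite ler_nat.
have : rho / 2 <= ln (n%:R / nu).
  rewrite -[X in X <= _]expRK ler_ln ?posrE ?expR_gt0 ?divr_gt0//.
    by rewrite ler_pdivlMr// mulrC ltW.
  by apply: le_lt_trans h; rewrite mulr_ge0 ?expR_ge0 ?ltW.
by rewrite /Rad; lra.
Qed.

(** * Gaussian estimates *)

Section Normal.
Context {R : realType}.

Lemma normal_pdf0E (tau y : R) : 0 < tau ->
  normal_pdf 0 tau y =
    (tau * Num.sqrt (pi *+ 2))^-1 * expR (- (y ^+ 2 / (2 * tau ^+ 2))).
Proof.
move=> t0; rewrite normal_pdfE ?gt_eqF//; congr (_ * _).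
  rewrite /normal_peak -mulrnAr sqrtrM ?sqr_ge0// sqrtr_sqr gtr0_norm//.
by rewrite /normal_fun subr0 mulNr mulr_natl.
Qed.

(** On a window one standard deviation long, the density is at least [c / tau], so the mass of the
    window is at least a [c] that does not depend on [tau]. *)
Lemma normal_prob_lower (k : R) : exists2 c : R, 0 < c &
  forall tau a (A : set R), 0 < tau -> measurable A ->
    `[a, a + tau]%classic `<=` A ->
    (forall y, a <= y <= a + tau -> `|y| <= k * tau) ->
    (c%:E <= normal_prob 0 tau A)%E.
Proof.
have pi2 : 0 < Num.sqrt (pi *+ 2) :> R by rewrite sqrtr_gt0 mulrn_wgt0 ?pi_gt0.
set c := (Num.sqrt (pi *+ 2))^-1 * expR (- (k ^+ 2 / 2)).
have c0 : 0 < c by rewrite mulr_gt0 ?invr_gt0 ?expR_gt0.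
exists c => // tau a A t0 mA IA yk.
have mI : measurable `[a, a + tau]%classic by exact: measurable_itv.
apply: (@le_trans _ _ (normal_prob 0 tau `[a, a + tau]%classic)); last first.
  by apply: le_measure; rewrite ?inE.
rewrite /normal_prob.
have -> : c%:E = (\int[lebesgue_measure]_(x in [set` `[a, a + tau]%R]) (c / tau)%:E)%E.
  rewrite integral_cst//= lebesgue_measure_itv/= lte_fin ltrDl t0.
  by rewrite -EFinB -EFinM addrAC subrr add0r divfK// gt_eqF.
apply: ge0_le_integral => //.
- by move=> x _; rewrite lee_fin divr_ge0 ?ltW.
- apply/measurable_EFinP; apply: measurable_funTS; exact: measurable_normal_pdf.
move=> x /=; rewrite in_itv/= => /yk xk.
rewrite lee_fin normal_pdf0E// /c mulrC invfM -[leRHS]mulrA ler_pM2l ?invr_gt0//.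
rewrite ler_pM2l ?invr_gt0// ler_expR lerN2.
rewrite ler_pdivrMr ?mulr_gt0 ?exprn_gt0//.
have -> : k ^+ 2 / 2 * (2 * tau ^+ 2) = (k * tau) ^+ 2 by field.
rewrite -real_normK ?num_real// ler_sqr ?nnegrE//.
exact: le_trans xk.
Qed.

Lemma measurable_norm_ge (x : R) : measurable [set y : R | x <= `|y|].
Proof.
rewrite (_ : [set y : R | x <= `|y|] = (fun y : R => `|y|) @^-1` [set` `[x, +oo[%R]).
  have : measurable_fun setT (fun y : R => `|y|) by exact: normr_measurable.
  by move=> /(_ measurableT)/(_ [set` `[x, +oo[%R]); rewrite setTI; apply; exact: measurable_itv.
by apply/seteqP; split => y /=; rewrite in_itv/= andbT.
Qed.

(** Follows from [expR u >= 1 + u ^+ 2 / 2]. Applied to [u] of order [x ^+ 2 / tau ^+ 2], it gives a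
    tail of order four. *)
Lemma expRN_le (u : R) : 0 < u -> expR (- u) <= 2 / u ^+ 2.
Proof.
move=> u0; rewrite expRN -[2 / _]invf_div lef_pV2 ?posrE ?expR_gt0 ?divr_gt0 ?exprn_gt0//.
by apply: le_trans (expR_ge1Dxn 1 (ltW u0)); rewrite lerDr.
Qed.

(* On [x <= |y|] the density of N(0, tau^2) is at most
   [2 exp (- 3 x^2 / (8 tau^2))] times that of N(0, 4 tau^2). *)
Lemma normal_prob_tail (tau x : R) : 0 < tau -> 0 < x ->
  (normal_prob 0 tau [set y : R | x <= `|y|]%R <= (29 * (tau ^+ 4 / x ^+ 4))%:E)%E.
Proof.
move=> t0 x0; rewrite /normal_prob; set A := [set y : R | _].
have pi2 : 0 < Num.sqrt (pi *+ 2) :> R by rewrite sqrtr_gt0 mulrn_wgt0 ?pi_gt0.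
have mA : measurable A by exact: measurable_norm_ge.
(* With [u = 3 * x ^+ 2 / (8 * tau ^+ 2)], the ratio of densities is at most
   [2 * expR (- u) <= 4 / u ^+ 2], which is [256 / 9] times [tau ^+ 4 / x ^+ 4], and
   [256 / 9 < 29]. *)
set K := 29 * (tau ^+ 4 / x ^+ 4).
have K0 : 0 <= K by rewrite mulr_ge0// divr_ge0// exprn_ge0// ltW.
have mK : measurable_fun setT (fun y : R => (K * normal_pdf 0 (2 * tau) y)%:E).
  by apply/measurable_EFinP; apply: measurable_funM => //; exact: measurable_normal_pdf.
apply: (@le_trans _ _ (\int[lebesgue_measure]_(y in A) (K * normal_pdf 0 (2 * tau) y)%:E)%E).
  apply: ge0_le_integral => //.
  - by move=> y _; rewrite lee_fin normal_pdf_ge0.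
  - by apply/measurable_EFinP; apply: measurable_funTS; exact: measurable_normal_pdf.
  - exact: measurable_funTS.
  move=> y /= xy; rewrite lee_fin !normal_pdf0E ?mulr_gt0//.
  have -> : (2 * tau * Num.sqrt (pi *+ 2))^-1 = (tau * Num.sqrt (pi *+ 2))^-1 / 2.
    by field; rewrite !gt_eqF.
  rewrite [leRHS]mulrCA -[leRHS]mulrA ler_pM2l ?invr_gt0 ?mulr_gt0//.
  have yx : x ^+ 2 <= y ^+ 2 by rewrite -[leRHS]real_normK ?num_real// ler_sqr ?nnegrE// ltW.
  have -> : - (y ^+ 2 / (2 * tau ^+ 2)) =
      - (3 * y ^+ 2 / (8 * tau ^+ 2)) - y ^+ 2 / (2 * (2 * tau) ^+ 2).
    by field; rewrite gt_eqF.
  rewrite expRD [leRHS]mulrA ler_pM2r ?expR_gt0//.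
  have u0 : 0 < 3 * x ^+ 2 / (8 * tau ^+ 2) by rewrite divr_gt0 ?mulr_gt0 ?exprn_gt0.
  apply: (@le_trans _ _ (expR (- (3 * x ^+ 2 / (8 * tau ^+ 2))))).
    by rewrite ler_expR lerN2 ler_pM2r ?invr_gt0 ?mulr_gt0 ?exprn_gt0// ler_pM2l.
  apply: le_trans (expRN_le u0) _.
  have -> : 2 / (3 * x ^+ 2 / (8 * tau ^+ 2)) ^+ 2 = (128 / 9) * (tau ^+ 4 / x ^+ 4).
    by field; rewrite !gt_eqF.
  have : 0 <= tau ^+ 4 / x ^+ 4 by rewrite divr_ge0// exprn_ge0// ltW.
  by rewrite /K; lra.
apply: (@le_trans _ _ (\int[lebesgue_measure]_y (K * normal_pdf 0 (2 * tau) y)%:E)%E).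
  apply: ge0_subset_integral => //.
  by move=> y _; rewrite lee_fin mulr_ge0// normal_pdf_ge0.
under eq_integral do rewrite EFinM.
rewrite ge0_integralZl//; last 2 first.
- by apply/measurable_EFinP; exact: measurable_normal_pdf.
- by move=> y _; rewrite lee_fin normal_pdf_ge0.
by rewrite integral_normal_pdf mule1.
Qed.

Lemma Phi_gt0 (x : R) : 0 < Phi x.
Proof.
have [c c0 hc] := normal_prob_lower (`|x| + 1).
have mA : measurable `]-oo, x]%classic by exact: measurable_itv.
have h : (c%:E <= normal_prob 0 1 `]-oo, x])%E.
  apply: (hc _ (x - 1)) => //.
    by move=> y /=; rewrite !in_itv/= subrK => /andP[].
  move=> y; rewrite subrK mulr1 => /andP[y1 y2].
  rewrite ler_norml; have := ler_norm x; have := ler_norm (- x); rewrite normrN.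
  by move=> h1 h2; apply/andP; split; lra.
have f : normal_prob 0 1 `]-oo, x] \is a fin_num by exact: fin_num_measure.
by apply: lt_le_trans c0 _; rewrite -lee_fin /Phi fineK.
Qed.

End Normal.

(** * Law of a single Brownian increment *)

Section Brownian.
Context {R : realType} d (Omega : measurableType d) (P : probability Omega R).
Variable B : R -> Omega -> R.
Hypothesis hB : is_std_BM P B.

(** The defining property speaks of a strictly increasing infinite sequence of times starting at 0.
    It is applied to [0, b, b + 1, ...] if [a = 0], and otherwise to [0, a, b, b + 1, ...] with the
    first increment left free. *)
Lemma BM_increment (a b : R) (A : set R) : 0 <= a -> a < b -> measurable A ->
  P [set w | A (B b w - B a w)] = normal_prob 0 (Num.sqrt (b - a)) A.
Proof.
case: hB => mB B0 cB iB; rewrite le_eqVlt => /predU1P[<-|a0] ab mA.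
  pose t (i : nat) : R := if i is j.+1 then b + j%:R else 0.
  have ht i : t i < t i.+1 by case: i => [|i]; rewrite /t ?addr0// ltrD2l ltr_nat.
  have := iB 1%N t (fun=> A) erefl ht (fun=> mA).
  rewrite big_ord_recl big_ord0 mule1 /= addr0 subr0 => <-; congr (P _).
  by apply/seteqP; split => w /=; [move=> h [|//]|move=> /(_ 0%N)]; rewrite ?addr0//; apply.
pose t (i : nat) : R := if i is j.+1 then if j is l.+1 then b + l%:R else a else 0.
pose S (i : nat) : set R := if i is 1%N then A else setT.
have ht i : t i < t i.+1 by case: i => [|[|i]]; rewrite /t ?addr0// ltrD2l ltr_nat.
have hS i : measurable (S i) by case: i => [|[|i]] //; exact: measurableT.
have := iB 2%N t S erefl ht hS.
rewrite !big_ord_recl big_ord0 mule1 /= probability_setT mul1e addr0 => <-; congr (P _).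
apply/seteqP; split => w /=; first by move=> h [|[|]]//= _; rewrite addr0.
by move=> /(_ 1%N)/=; rewrite addr0; apply.
Qed.

End Brownian.

(** * Hitting times of continuous processes *)

Section Paths.
Context {R : realType}.

Lemma within_continuous_gt (f : R -> R) (c t : R) :
  {within [set` `[0%R, +oo[%R], continuous f} -> 0 <= t -> c < f t ->
  exists2 e : R, 0 < e & forall u, 0 <= u -> `|t - u| < e -> c < f u.
Proof.
move=> /subspace_continuousP cf t0 ct.
have /cf/cvgrPdist_lt /(_ (f t - c)) : [set` `[0%R, +oo[%R] t by rewrite /= in_itv/= t0.
rewrite subr_gt0 => /(_ ct); rewrite /prop_near1 /within/= => /nbhs_ballP[e /= e0 he].
exists e => // u u0 tu; have := he u tu; rewrite in_itv/= u0 => /(_ isT).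
by have := ler_norm (f t - f u); lra.
Qed.

Lemma expn2_gt (x : R) : exists m : nat, x < 2 ^+ m.
Proof.
exists (Num.truncn x).+1; apply: lt_le_trans (truncnS_gt x) _.
by rewrite -natrX ler_nat ltnW// ltn_expl.
Qed.

(** If [f] exceeded [c] at [t], it would do so on a neighbourhood of [t], which contains a dyadic
    fraction of [T]. *)
Lemma dyadic_dense_le (f : R -> R) (T c : R) : 0 <= T ->
  {within [set` `[0%R, +oo[%R], continuous f} ->
  (forall m i, (i <= 2 ^ m)%N -> f (T * (i%:R / 2 ^+ m)) <= c) ->
  forall t, 0 <= t <= T -> f t <= c.
Proof.
rewrite le_eqVlt => /predU1P[<- _ h t t0|T0 cf h t /andP[t0 tT]].
  have -> : t = 0 * (0%:R / 2 ^+ 0) by rewrite mul0r; lra.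
  exact: h.
rewrite leNgt; apply/negP => ct.
have [e e0 he] := within_continuous_gt cf t0 ct.
have [m hm] := expn2_gt (T / e).
have m0 : 0 < 2 ^+ m :> R by rewrite exprn_gt0.
(* Rounding down puts the grid point in []t - e, t]], since the mesh [T / 2 ^+ m] is below [e]. *)
pose i := Num.truncn (t / T * 2 ^+ m).
have x0 : 0 <= t / T * 2 ^+ m by rewrite mulr_ge0 ?divr_ge0// ltW.
have /andP[i1 i2] := truncn_itv x0; rewrite -/i in i1 i2.
have im : (i <= 2 ^ m)%N.
  rewrite -(ler_nat R) natrX; apply: le_trans i1 _.
  by rewrite ger_pMl// ler_pdivrMr// mul1r.
have := h m i im; apply/negP; rewrite -ltNge; apply: he.
  by rewrite mulr_ge0 ?divr_ge0 ?(ltW T0) ?(ltW m0).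
rewrite ltr_pdivrMr// in hm.
have u1 : T * (i%:R / 2 ^+ m) <= t.
  rewrite mulrA ler_pdivrMr// mulrC -ler_pdivlMr//.
  by apply: le_trans i1 _; rewrite mulrAC.
have u2 : t < T * (i%:R / 2 ^+ m) + e.
  have : t * 2 ^+ m < T * i.+1%:R.
    by rewrite (mulrC T) -ltr_pdivrMr// mulrAC.
  have -> : i.+1%:R = i%:R + 1 :> R by rewrite natr1.
  rewrite mulrDr mulr1 => h1.
  rewrite -(ltr_pM2r m0) mulrDl mulrA divfK ?gt_eqF//.
  by apply: lt_trans h1 _; rewrite ltrD2l mulrC.
by rewrite ger0_norm; lra.
Qed.

End Paths.

Section Hitting.
Context {R : realType} d (Omega : measurableType d).
Variables (X : R -> Omega -> R) (c s : R).
Hypothesis s0 : 0 <= s.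
Hypothesis mX : forall t, 0 <= t -> measurable_fun setT (X t).
Hypothesis cX : forall w, {within [set` `[0%R, +oo[%R], continuous (X^~ w)}.

(** The infimum could be at most [s] without a hit by time [s] only if hits accumulated at [s] from
    the right. Continuity excludes this: if [X s w < c], the path stays below [c] until some
    [s + e]. *)
Lemma hitting_time_le :
  [set w | (ereal_inf [set t%:E | t in [set t : R | (0 <= t)%R /\ (c <= X t w)%R]]
             <= s%:E)%E]
  = [set w | exists2 t, 0 <= t <= s & c <= X t w].
Proof.
apply/seteqP; split => w /=; last first.
  move=> [t /andP[t0 ts] h]; apply: ge_ereal_inf; exists t%:E => //.
  by exists t.
move=> h; apply: contrapT => nh.
have hs : X s w < c.
  by rewrite ltNge; apply/negP => hs; apply: nh; exists s; rewrite ?s0 ?lexx.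
have cN : {within [set` `[0%R, +oo[%R], continuous (fun t => - X t w)}.
  by move=> t; apply: cvgN; exact: cX.
have [|e e0 he] := @within_continuous_gt _ (fun t => - X t w) (- c) s cN s0.
  by rewrite ltrN2.
have : (s%:E < (s + e)%:E)%E by rewrite lte_fin ltrDl.
rewrite ltNge => /negP; apply; apply: le_trans h.
apply/ereal_infP => _ [t /= [t0 ht] <-]; rewrite lee_fin leNgt; apply/negP => te.
have [ts|ts] := leP t s; first by apply: nh; exists t; rewrite ?t0.
have := he t t0; rewrite ltrN2 ler0_norm ?subr_le0 ?(ltW ts)// opprB => /(_ _).
move=> h1; have : X t w < c by apply: h1; lra.
by rewrite ltNge ht.
Qed.

(** A path that does not reach [c] on the compact [[0, s]] has its maximum at least [1 / (k + 1)]
    below [c] for some [k], and by density this is tested at dyadic times only. The complement is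
    thus a countable combination of measurable events. *)
Lemma measurable_hitting :
  measurable [set w | exists2 t, 0 <= t <= s & c <= X t w].
Proof.
pose G k m i := [set w | (i <= 2 ^ m)%N -> X (s * (i%:R / 2 ^+ m)) w <= c - k.+1%:R^-1].
have -> : [set w | exists2 t, 0 <= t <= s & c <= X t w] =
    ~` (\bigcup_k \bigcap_m \bigcap_i G k m i).
  rewrite -[LHS]setCK; congr (~` _); apply/seteqP; split => w /=; last first.
    move=> [k _ hk] [t ts ct].
    have : X t w <= c - k.+1%:R^-1.
      apply: (dyadic_dense_le s0 (cX (w := w))) => // m i im.
      exact: (hk m I i I im).
    have : 0 < k.+1%:R^-1 :> R by rewrite invr_gt0.
    by move: (_^-1) => y; lra.
  move=> nh; have cs : {within [set` `[0%R, s]%R], continuous (X^~ w)}.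
    apply: continuous_subspaceW (cX (w := w)) => t /=.
    by rewrite !in_itv/= andbT => /andP[].
  have [u] := EVT_max s0 cs; rewrite in_itv/= => us hu.
  have uc : X u w < c by rewrite ltNge; apply/negP => uc; apply: nh; exists u.
  (* This [k] makes [1 / (k + 1)] at most the gap between [c] and the maximum [X u w]. *)
  exists (Num.truncn (c - X u w)^-1) => // m _ i _ im.
  apply: (@le_trans _ _ (X u w)).
    apply: hu; rewrite in_itv/= mulr_ge0 ?divr_ge0//= ler_piMr//.
    by rewrite ler_pdivrMr ?exprn_gt0// mul1r -natrX ler_nat.
  rewrite lerBrDr -lerBrDl invf_ple ?posrE ?subr_gt0//.
  exact/ltW/truncnS_gt.
apply: measurableC; apply: bigcupT_measurable => k.
apply: bigcapT_measurable => m; apply: bigcapT_measurable => i.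
rewrite /G; case: (leqP i (2 ^ m)) => im; last first.
  by rewrite (_ : [set w | _] = setT)//; apply/seteqP; split.
have h0 : 0 <= s * (i%:R / 2 ^+ m) by rewrite mulr_ge0 ?divr_ge0.
have := mX h0 measurableT (measurable_itv `]-oo, c - k.+1%:R^-1]).
rewrite setTI; congr (measurable _).
by apply/seteqP; split => w /=; rewrite in_itv/= => h //; exact: h.
Qed.

End Hitting.

(** * Maximal inequality for Brownian motion *)

(* At level [j] the increment threshold is [(a / 2) (1 / 10) (9 / 10)^j]: these sum
   to [a / 2], and the [2^j] increments contribute
   [29 * 20^4 * (T^2 / a^4) * (2 (9 / 10)^4)^-j], which is summable. *)
Definition chaining_const (R : realType) : R :=
  29 * 20 ^+ 4 / (1 - (2 * (9 / 10) ^+ 4)^-1).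

Lemma chaining_const_gt0 (R : realType) : 0 < chaining_const R.
Proof.
rewrite /chaining_const divr_gt0//.
by rewrite subr_gt0 invf_lt1; lra.
Qed.

Section Chaining.
Context {R : realType}.

(** Induction on the level: an even index already lies on the coarser grid, and an odd one is a
    single increment away from it. The thresholds add up to the geometric sum
    [A * (1 - q) * (1 + q + ... + q ^+ m)]. *)
Lemma dyadic_chain (f : R -> R) (T A q : R) : f 0 = 0 ->
  (forall j i, (i < 2 ^ j)%N ->
     `|f (T * (i.+1%:R / 2 ^+ j)) - f (T * (i%:R / 2 ^+ j))| <= A * (1 - q) * q ^+ j) ->
  forall m i, (i <= 2 ^ m)%N -> `|f (T * (i%:R / 2 ^+ m))| <= A * (1 - q ^+ m.+1).
Proof.
move=> f0 h.
have h01 : f (T * (0%:R / 2 ^+ 0)) = 0 by rewrite mul0r mulr0.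
have A0 : 0 <= A * (1 - q).
  by have := h 0%N 0%N isT; rewrite expr0 mulr1; exact: le_trans.
elim=> [|m IH] i.
  case: i => [|[|//]] _; first by rewrite h01 normr0 expr1.
  by have := h 0%N 0%N isT; rewrite h01 subr0 mulr1 expr1.
rewrite expnS mul2n => im.
have half k : T * (k.*2%:R / 2 ^+ m.+1) = T * (k%:R / 2 ^+ m).
  by rewrite -mul2n natrM exprS; congr (_ * _); rewrite invfM mulrACA divff ?mul1r.
have mono : A * (1 - q ^+ m.+1) + A * (1 - q) * q ^+ m.+1 = A * (1 - q ^+ m.+2).
  by rewrite [q ^+ m.+2]exprS; ring.
rewrite -(odd_double_half i) in im *; set k := i./2 in im *.
move: im; case: (odd i) => /=; rewrite ?add1n ?add0n => im.
  have km : (k < 2 ^ m)%N by rewrite -ltn_double (leq_trans _ im).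
  have h1 : `|f (T * (k.*2.+1%:R / 2 ^+ m.+1)) - f (T * (k%:R / 2 ^+ m))|
      <= A * (1 - q) * q ^+ m.+1.
    by rewrite -half; apply: h; rewrite expnS mul2n (leq_trans _ im).
  rewrite -mono -[f _](subrK (f (T * (k%:R / 2 ^+ m)))) addrC.
  apply: le_trans (ler_normD _ _) _; apply: lerD => //.
  exact: IH (ltnW km).
rewrite half -mono.
have km : (k <= 2 ^ m)%N by rewrite -leq_double.
apply: le_trans (IH _ km) _; rewrite lerDl.
by have := h m.+1 0%N; rewrite expn_gt0 => /(_ isT); exact: le_trans.
Qed.

Context d (Omega : measurableType d) (P : probability Omega R).
Variable B : R -> Omega -> R.
Hypothesis hB : is_std_BM P B.

(** The ratio must satisfy [2 * q ^+ 4 > 1], that is [p < 1]: the [2 ^ j] increments of level [j]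
    together fail with probability of order [p ^+ j]. *)
Let q : R := 9 / 10.
Let K0 : R := 29 * (20 ^+ 4).
Let p : R := (2 * q ^+ 4)^-1.

(** The increment is centred normal of variance [T / 2 ^+ j], so the fourth-order tail applies. The
    factor [2^-1] is set apart to absorb the number [2 ^ j] of increments in the union bound. *)
Lemma dyadic_increment_tail (T a : R) (j i : nat) : 0 < T -> 0 < a ->
  (P [set w | (a / 2) * (1 - q) * q ^+ j <=
       `|B (T * (i.+1%:R / 2 ^+ j)) w - B (T * (i%:R / 2 ^+ j)) w| ]%R
   <= (K0 * (T ^+ 2 / a ^+ 4) * (2^-1 * p) ^+ j)%:E)%E.
Proof.
move=> T0 a0.
have q0 : 0 < q by rewrite /q.
have q1 : 0 < 1 - q by rewrite /q; lra.
have e0 : 0 < 2 ^+ j :> R by rewrite exprn_gt0.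
set x := a / 2 * (1 - q) * q ^+ j.
have x0 : 0 < x by rewrite !mulr_gt0 ?exprn_gt0.
have u0 : 0 <= T * (i%:R / 2 ^+ j) by apply: mulr_ge0; [exact: ltW|apply: divr_ge0 => //; exact: ltW].
have uv : T * (i%:R / 2 ^+ j) < T * (i.+1%:R / 2 ^+ j).
  by rewrite ltr_pM2l// ltr_pM2r ?invr_gt0// ltr_nat.
have mA : measurable [set y : R | x <= `|y|] by exact: measurable_norm_ge.
have := BM_increment hB u0 uv mA; rewrite /= => ->.
have -> : T * (i.+1%:R / 2 ^+ j) - T * (i%:R / 2 ^+ j) = T / 2 ^+ j.
  rewrite (_ : i.+1%:R = i%:R + 1 :> R) ?natr1//; ring.
have t0 : 0 < T / 2 ^+ j by rewrite divr_gt0.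
have s0 : 0 < Num.sqrt (T / 2 ^+ j) by rewrite sqrtr_gt0.
apply: le_trans (normal_prob_tail s0 x0) _; rewrite lee_fin.
have -> : Num.sqrt (T / 2 ^+ j) ^+ 4 = (T / 2 ^+ j) ^+ 2.
  by rewrite (_ : 4 = 2 * 2)%N// exprM sqr_sqrtr// ltW.
have -> : x = a / 2 * 10^-1 * q ^+ j by rewrite /x; congr (_ * _ * _); rewrite /q; field.
have -> : (2^-1 * p) ^+ j = ((2 ^+ j) ^+ 2 * (q ^+ j) ^+ 4)^-1.
  by rewrite /p -invfM exprVn mulrA -expr2 exprMn -!exprM !(mulnC j).
have qj : q ^+ j != 0 by rewrite expf_neq0// gt_eqF.
rewrite le_eqVlt; apply/orP; left; apply/eqP; rewrite /K0.
move: (2 ^+ j) (q ^+ j) e0 qj => e z e0 z0.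
by field; rewrite z0 !gt_eqF.
Qed.

(* Chaining: a union bound over the dyadic increments of all levels, which uses
   only the one-dimensional marginals of the increments. *)
Lemma BM_maximal (T a : R) : 0 < T -> 0 < a ->
  exists E : set Omega, [/\ measurable E, (P E <= (chaining_const R * (T ^+ 2 / a ^+ 4))%:E)%E &
    forall w, ~ E w -> forall t, 0 <= t <= T -> `|B t w| < a].
Proof.
move=> T0 a0; have [mB B0 cB _] := hB.
have p0 : 0 < p by rewrite /p /q; lra.
have p1 : p < 1 by rewrite /p /q invf_lt1; lra.
have K00 : 0 < K0 by rewrite /K0; lra.
pose V j i := [set w | (a / 2) * (1 - q) * q ^+ j <=
       `|B (T * (i.+1%:R / 2 ^+ j)) w - B (T * (i%:R / 2 ^+ j)) w| ].
pose U j := \big[setU/set0]_(i < 2 ^ j) V j i.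
have mV j i : measurable (V j i).
  have : measurable_fun setT (fun w => `|B (T * (i.+1%:R / 2 ^+ j)) w - B (T * (i%:R / 2 ^+ j)) w|).
    apply: measurableT_comp; first exact: normr_measurable.
    by apply: measurable_funB.
  move=> /(_ measurableT)/(_ [set` `[a / 2 * (1 - q) * q ^+ j, +oo[%R]); rewrite setTI => /(_ (measurable_itv _)).
  by congr measurable; apply/seteqP; split => w /=; rewrite in_itv/= andbT.
have mU j : measurable (U j) by apply: bigsetU_measurable => i _.
have mE : measurable (\bigcup_j U j) by apply: bigcupT_measurable.
exists (\bigcup_j U j); split => //.
  apply: (le_trans (@measure_sigma_subadditive _ _ _ P (\bigcup_j U j) U mU mE (fun _ h => h))).
  set D := K0 * (T ^+ 2 / a ^+ 4).
  have D0 : 0 <= D by rewrite mulr_ge0 ?divr_ge0 ?exprn_ge0 ?ltW.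
  have PU j : (P (U j) <= (geometric D p j)%:E)%E.
    apply: le_trans (le_mu_bigsetU _ _) _; first by move=> i _.
    apply: (@le_trans _ _ (\sum_(i < 2 ^ j) (D * (2^-1 * p) ^+ j)%:E)%E).
      by apply: lee_sum => i _; exact: dyadic_increment_tail.
    rewrite sumEFin big_const_ord iter_addr_0 lee_fin -/D /geometric/=.
    rewrite exprMn -[leLHS]mulr_natr natrX -mulrA ler_wpM2l// mulrAC exprVn mulVf ?mul1r ?expf_neq0//.
  apply: lime_le; first by apply: is_cvg_nneseries => j _ _; exact: measure_ge0.
  apply: nearW => n; apply: (@le_trans _ _ (\sum_(0 <= j < n) (geometric D p j)%:E)%E).
    by apply: lee_sum => j _; exact: PU.
  rewrite sumEFin lee_fin.
  have -> : chaining_const R * (T ^+ 2 / a ^+ 4) = D / (1 - p) by rewrite /chaining_const -/q -/p -/K0 /D mulrAC.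
  by apply: (geometric_le_lim n D0 p0); rewrite ger0_norm ?(ltW p0).
move=> w nE t tT.
have hc := @dyadic_chain (B^~ w) T (a / 2) q (B0 w).
(* Density of the dyadic times passes on only a weak inequality; chaining up to [a / 2] leaves room
   for the strict one. *)
apply: (@le_lt_trans _ _ (a / 2)); last lra.
have cw : {within [set` `[0%R, +oo[%R], continuous (fun t => `|B t w|)}.
  by move=> u; apply: (@cvg_norm _ R^o); exact: cB.
apply: (dyadic_dense_le (ltW T0) cw) => // m i im.
apply: le_trans (hc _ m i im) _.
  move=> j k kj; apply: ltW; rewrite ltNge; apply/negP => h; apply: nE.
  exists j => //; rewrite /U -bigcup_mkord; exists k => //.
have : 0 < q ^+ m.+1 by rewrite exprn_gt0// /q.
move: (q ^+ m.+1) => z z0; nra.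
Qed.

End Chaining.

(** * Integrals of nonnegative functions *)

Section NonnegIntegral.
Local Open Scope ereal_scope.
Context d (T : measurableType d) (R : realType) (mu : {measure set T -> \bar R}).

(* The integral of a nonnegative function is a supremum over simple functions, so
   this and the next lemma need no measurability; this spares proving that [Pdet]
   is measurable in its starting point. *)
Lemma le_integral_ge0 (D E : set T) (f g : T -> \bar R) :
  (forall x, D x -> 0 <= f x) -> (forall x, E x -> 0 <= g x) ->
  (forall x, D x -> 0 < f x -> E x /\ f x <= g x) ->
  \int[mu]_(x in D) f x <= \int[mu]_(x in E) g x.
Proof.
move=> f0 g0 fg; rewrite !ge0_integralE//.
(* Each simple function below [f] on [D] is also below [g] on [E], both extended by 0: where [f]
   vanishes, nonnegativity of [g] suffices. *)
apply: ge_ereal_sup => _ [h /= hf <-]; apply: ereal_sup_ubound; exists h => //= x.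
apply: le_trans (hf x) _; rewrite /patch; case: ifPn => [/set_mem Dx|_].
  have := f0 x Dx; rewrite le_eqVlt => /predU1P[<-|fx0].
    by case: ifPn => // /set_mem/g0.
  by have [Ex fgx] := fg x Dx fx0; rewrite mem_set.
by case: ifPn => // /set_mem/g0.
Qed.

Import HBNNSimple.

Lemma integral_scale_le (D : set T) (f : T -> \bar R) (k : R) :
  (0 < k)%R -> (forall x, D x -> 0 <= f x) ->
  \int[mu]_(x in D) (k%:E * f x) <= k%:E * \int[mu]_(x in D) f x.
Proof.
move=> k0 f0; rewrite !ge0_integralE//; last first.
  by move=> x Dx; rewrite mule_ge0 ?f0// lee_fin ltW.
have ki0 : (0 <= k^-1)%R by rewrite invr_ge0 ltW.
apply: ge_ereal_sup => _ [h /= hf <-].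
pose h' := scale_nnsfun h ki0.
have -> : sintegral mu h = k%:E * sintegral mu h'.
  rewrite -sintegralrM; apply: eq_sintegral => x /=.
  by rewrite mulrA divff ?mul1r// gt_eqF.
rewrite lee_pmul2l//; apply: ereal_sup_ubound; exists h' => //= x.
have := hf x; rewrite /patch; case: ifPn => Dx hx.
  by rewrite EFinM -[leRHS]mul1e -[1]/(1%:E) -(@mulVf _ k) ?gt_eqF// EFinM -muleA lee_pmul2l ?lte_fin ?invr_gt0.
by rewrite EFinM pmule_rle0// lte_fin invr_gt0.
Qed.

End NonnegIntegral.

(** * Integrals of inverse squares over two symmetric intervals *)

Section InverseSquare.
Context {R : realType}.

(** The sign [e], equal to 1 or -1, lets one formula serve both half-lines, where [e * t] is the
    absolute value of [t]. [F] is a primitive of [f] since [e * e = 1]. *)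
Let f (e c p : R) := fun t : R => c / (e * t - p) ^+ 2.
Let F (e c p : R) := fun t : R => - (e * c) * (e * t - p)^-1.

Lemma is_derive_inv_affine (e c p t : R) : e * e = 1 -> e * t - p != 0 ->
  is_derive t 1 (F e c p) (f e c p t).
Proof.
move=> ee h; rewrite /F.
have hd : is_derive t 1 (fun y : R => e * y - p) e.
  by apply: is_derive_eq; rewrite subr0 /GRing.scale/= mulr1.
have := @is_deriveV R (fun y : R => e * y - p) t e 1 h hd => hv.
apply: is_derive_eq; rewrite /GRing.scale/= /f.
have -> : - (e * c) * (- (e * t - p) ^- 2 * e) = c * (e * e) / (e * t - p) ^+ 2.
  by field.
by rewrite ee mulr1.
Qed.

Lemma continuous_inv_square (e c p x y : R) :
  (forall t, x <= t <= y -> 0 < e * t - p) ->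
  {within [set` `[x, y]], continuous (f e c p)}.
Proof.
move=> h; apply: continuous_in_subspaceT => t; rewrite inE/= in_itv/= => /h ht.
rewrite /f; apply: cvgM; first exact: cvg_cst.
apply: cvgV; first by rewrite gt_eqF// exprn_gt0.
have -> : (fun u : R => (e * u - p) ^+ 2) = (fun u => (e * u - p) * (e * u - p)).
  by apply/funext => u; rewrite expr2.
have ha : (e * u - p @[u --> t] --> e * t - p)%classic.
  by apply: cvgB; [apply: cvgM; [exact: cvg_cst|exact: cvg_id]|exact: cvg_cst].
by rewrite expr2; apply: cvgM.
Qed.

Lemma integral_inv_square (e c p x y : R) : e * e = 1 -> x < y ->
  (forall t, x <= t <= y -> 0 < e * t - p) ->
  (\int[lebesgue_measure]_(t in [set` `[x, y]%R]) (c / (e * t - p) ^+ 2)%:E =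
   (e * c / (e * x - p) - e * c / (e * y - p))%:E)%E.
Proof.
move=> ee xy h; have hd t : x <= t <= y -> is_derive t 1 (F e c p) (f e c p t).
  by move=> /h ht; apply: is_derive_inv_affine; rewrite ?gt_eqF.
have cF t : x <= t <= y -> {for t, continuous (F e c p)}.
  by move=> /hd ht; apply: differentiable_continuous; apply/derivable1_diffP; exact: ex_derive.
rewrite (@continuous_FTC2 _ (f e c p) (F e c p))//.
- by rewrite -EFinB /F; congr EFin; ring.
- exact: continuous_inv_square.
- split.
  + move=> t; rewrite in_itv/= => /andP[t1 t2].
    by have := hd t; rewrite (ltW t1) (ltW t2) => /(_ isT) ?; exact: ex_derive.
  + by apply: cvg_at_right_filter; apply: cF; rewrite lexx ltW.
  + by apply: cvg_at_left_filter; apply: cF; rewrite lexx ltW.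
- move=> t; rewrite in_itv/= => /andP[t1 t2].
  have := hd t; rewrite (ltW t1) (ltW t2) => /(_ isT) ht.
  by rewrite derive1E; exact: derive_val.
Qed.

Lemma integral_inv_square_tails (c p a : R) : 0 <= c -> 0 <= p -> p < a -> a < pi ->
  (\int[lebesgue_measure]_(t in [set` `[a, pi]%R] `|` [set` `[- pi, - a]%R])
     (c / (`|t| - p) ^+ 2)%:E <= (2 * (c / (a - p)))%:E)%E.
Proof.
move=> c0 p0 pa api.
have mA : measurable [set` `[a, pi]%R] by exact: measurable_itv.
have mB : measurable [set` `[- pi, - a]%R] by exact: measurable_itv.
have hA t : a <= t <= pi -> 0 < 1 * t - p by lra.
have hB t : - pi <= t <= - a -> 0 < (- 1) * t - p by lra.
have eA : {in [set` `[a, pi]%R], (fun t => c / (1 * t - p) ^+ 2) =1 (fun t => c / (`|t| - p) ^+ 2)}.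
  by move=> t; rewrite inE/= in_itv/= => /andP[t1 _]; rewrite ger0_norm ?mul1r//; lra.
have eB : {in [set` `[- pi, - a]%R], (fun t => c / (-1 * t - p) ^+ 2) =1 (fun t => c / (`|t| - p) ^+ 2)}.
  by move=> t; rewrite inE/= in_itv/= => /andP[_ t1]; rewrite ler0_norm ?mulN1r//; lra.
have IA : (\int[lebesgue_measure]_(t in [set` `[a, pi]%R]) (c / (`|t| - p) ^+ 2)%:E <= (c / (a - p))%:E)%E.
  have -> : (\int[lebesgue_measure]_(t in [set` `[a, pi]%R]) (c / (`|t| - p) ^+ 2)%:E =
      \int[lebesgue_measure]_(t in [set` `[a, pi]%R]) (c / (1 * t - p) ^+ 2)%:E)%E.
    by apply: eq_integral => t ht; congr EFin; rewrite -eA.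
  rewrite integral_inv_square ?mul1r// lee_fin.
  by rewrite gerBl divr_ge0 ?c0//; lra.
have IB : (\int[lebesgue_measure]_(t in [set` `[- pi, - a]%R]) (c / (`|t| - p) ^+ 2)%:E <= (c / (a - p))%:E)%E.
  have -> : (\int[lebesgue_measure]_(t in [set` `[- pi, - a]%R]) (c / (`|t| - p) ^+ 2)%:E =
      \int[lebesgue_measure]_(t in [set` `[- pi, - a]%R]) (c / (-1 * t - p) ^+ 2)%:E)%E.
    by apply: eq_integral => t ht; congr EFin; rewrite -eB.
  rewrite integral_inv_square ?mulrNN ?mulr1 ?ltrN2// lee_fin !mulN1r !mulNr mul1r !opprK.
  have : 0 <= c / (pi - p) by rewrite divr_ge0 ?c0//; lra.
  by rewrite ?mul1r; move: (c / (pi - p)) (c / (a - p)) => u v; lra.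
have mfA : measurable_fun [set` `[a, pi]%R] (fun t => (c / (`|t| - p) ^+ 2)).
  apply: eq_measurable_fun eA _; apply: subspace_continuous_measurable_fun => //.
  exact: continuous_inv_square.
have mfB : measurable_fun [set` `[- pi, - a]%R] (fun t => (c / (`|t| - p) ^+ 2)).
  apply: eq_measurable_fun eB _; apply: subspace_continuous_measurable_fun => //.
  exact: continuous_inv_square.
rewrite integral_setU//.
- rewrite mulr2n mulrDl mul1r EFinD; exact: leeD.
- by apply/measurable_EFinP; apply/measurable_funU.
- apply/disj_setPS => t /= []; rewrite !in_itv/= => /andP[h1 _] /andP[_ h2].
  by exfalso; lra.
Qed.

End InverseSquare.

(** * Detection probabilities *)

(** Paths are known to be continuous only on the half-line; [k >= 0] keeps the rescaled time in
    it. *)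
Lemma within_continuous_rescale (R : realType) (f g : R -> R) (k : R) : 0 <= k ->
  {within [set` `[0%R, +oo[%R], continuous f} -> continuous g ->
  {within [set` `[0%R, +oo[%R], continuous (fun t => g (f (t * k)))}.
Proof.
move=> k0 /subspace_continuousP cf cg; apply/subspace_continuousP => t.
rewrite /= in_itv/= andbT => t0.
have tk : [set` `[0%R, +oo[%R] (t * k) by rewrite /= in_itv/= andbT mulr_ge0.
apply: (@cvg_comp _ _ _ (fun t => f (t * k)) g); last exact: cg.
apply: (@cvg_comp _ _ _ (fun t => t * k) f); last exact: cf tk.
move=> V hV.
have h : (u * k @[u --> t] --> t * k)%classic by apply: cvgM; [exact: cvg_id|exact: cvg_cst].
have hV' : nbhs (t * k) (fun x => [set` `[0%R, +oo[%R] x -> V x) := hV.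
change (nbhs t (fun u => [set` `[0%R, +oo[%R] u -> V (u * k))).
apply: (@filterS _ (nbhs t) _ _ _ _ (h _ hV')) => u hu.
rewrite /= in_itv/= andbT => u0; apply: hu.
by rewrite /= in_itv/= andbT mulr_ge0.
Qed.

Section Detection.
Context {R : realType} d (Omega : measurableType d) (P : probability Omega R).
Variable B : R -> Omega -> R.
Hypothesis hB : is_std_BM P B.
Variables (beta Rd s r th : R).
Hypotheses (beta0 : 0 < beta) (Rd0 : 0 < Rd) (s0 : 0 <= s) (rR : 0 <= r <= Rd).

Let k : R := (sinh (beta * r) ^+ 2)^-1.
Let hit (t : R) (w : Omega) := hball (Rd, 0) Rd (r, th + B (t * k) w).

Let k0 : 0 <= k. Proof. by rewrite invr_ge0 sqr_ge0. Qed.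

Lemma detection_event :
  let E := [set w | exists2 t, 0 <= t <= s & hball (Rd, 0) Rd (r, th + B (t / sinh (beta * r) ^+ 2) w)] in
  measurable E /\ Pdet P B beta Rd s (r, th) = P E.
Proof.
move=> E; have [mB B0 cB _] := hB; have /andP[r0 _] := rR.
(* This is minus the hyperbolic cosine of the distance to the target, so entering the ball means
   that a continuous real process reaches the level [- cosh Rd]. *)
pose g (b : R) := sinh Rd * sinh r * cos (th + b) - cosh Rd * cosh r.
have cg : continuous g.
  move=> b; apply: cvgB; last exact: cvg_cst.
  apply: cvgM; first exact: cvg_cst.
  apply: (@cvg_comp _ _ _ (fun b => th + b) cos); last exact: continuous_cos.
  by apply: cvgD; [exact: cvg_cst|exact: cvg_id].
pose X t w := g (B (t * k) w).
have hX t w : hit t w <-> - cosh Rd <= X t w.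
  by rewrite /hit hballE// /X /g; split; lra.
have cX w : {within [set` `[0%R, +oo[%R], continuous (X^~ w)}.
  exact: within_continuous_rescale (cB w) cg.
have mX t : 0 <= t -> measurable_fun setT (X t).
  move=> _; apply: measurableT_comp (mB _).
  exact: continuous_measurable_fun.
have EX : E = [set w | exists2 t, 0 <= t <= s & - cosh Rd <= X t w].
  by apply/seteqP; split => w /= -[t ts] /hX ht; exists t.
split; first by rewrite EX; exact: measurable_hitting.
rewrite /Pdet EX -(hitting_time_le (- cosh Rd) s0 cX); congr (P _).
apply/funext => w; rewrite /mkset/= /Tdet; congr (is_true (ereal_inf _ <= _)%E).
by apply/seteqP; split => _ [t [t0 /hX ht] <-]; exists t.
Qed.

Lemma Pdet_le1 : (Pdet P B beta Rd s (r, th) <= 1)%E.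
Proof. by have [mE ->] := detection_event; exact: probability_le1. Qed.

Lemma Pdet_ge0 : (0 <= Pdet P B beta Rd s (r, th))%E.
Proof. exact: measure_ge0. Qed.

Lemma Pdet_start : hball (Rd, 0) Rd (r, th) -> Pdet P B beta Rd s (r, th) = 1%E.
Proof.
move=> h; have [mE ->] := detection_event; have [mB B0 cB _] := hB.
rewrite (_ : [set w | _] = setT) ?probability_setT//.
by apply/seteqP; split => // w _; exists 0; rewrite ?lexx// mul0r B0 addr0.
Qed.

Lemma Pdet_upper :
  0 < r -> phi Rd r < `|th| -> `|th| <= pi ->
  (Pdet P B beta Rd s (r, th) <=
     (chaining_const R * ((s / sinh (beta * r) ^+ 2) ^+ 2 / (`|th| - phi Rd r) ^+ 4))%:E)%E.
Proof.
move=> r0 pth thpi; have [mE ->] := detection_event; have [mB B0 cB _] := hB.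
have [p0 p1 _] := phi_spec Rd0 rR.
have rR' : 0 < r <= Rd by have /andP[_ ->] := rR; rewrite r0.
set a := `|th| - phi Rd r; have a0 : 0 < a by rewrite subr_gt0.
set E := [set w | _].
have sh : 0 < sinh (beta * r) by rewrite sinh_gt0 ?mulr_gt0.
have hit_displ w : E w -> exists2 u, 0 <= u <= s / sinh (beta * r) ^+ 2 & a <= `|B u w|.
  move=> [t /andP[t0 ts]]; move/(hball_phi _ Rd0 rR') => h.
  exists (t / sinh (beta * r) ^+ 2).
    by rewrite divr_ge0 ?exprn_ge0 ?(ltW sh)//= ler_pM2r// invr_gt0 exprn_gt0.
  exact: cos_displacement (ltW p0) pth thpi h.
(* The maximal inequality is for positive time; at [s = 0] the path has not moved and the event is
   empty. *)
have [s00|s00] := eqVneq s 0.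
  rewrite (_ : E = set0); first rewrite measure0 lee_fin.
    by apply: mulr_ge0; [exact/ltW/chaining_const_gt0|apply: divr_ge0; rewrite exprn_even_ge0].
  apply/seteqP; split => // w /hit_displ[u]; rewrite s00 mul0r => u0.
  have -> : u = 0 by lra.
  by rewrite B0 normr0 leNgt a0.
have T0 : 0 < s / sinh (beta * r) ^+ 2 by rewrite divr_gt0 ?exprn_gt0// lt_neqAle eq_sym s00.
have [F [mF PF hF]] := BM_maximal hB T0 a0.
apply: le_trans PF; apply: le_measure; rewrite ?inE//.
move=> w /hit_displ[u us au]; apply: contrapT => nF.
by have := hF w nF u us; rewrite ltNge au.
Qed.

(** The Gaussian lower bound enters as a hypothesis on [c], so that the same [c] serves all times,
    radii and probability spaces. *)
Lemma Pdet_lower (kappa c : R) : 0 < kappa ->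
  (forall tau a (A : set R), 0 < tau -> measurable A ->
    `[a, a + tau]%classic `<=` A ->
    (forall y, a <= y <= a + tau -> `|y| <= (kappa + 1) * tau) ->
    (c%:E <= normal_prob 0 tau A)%E) ->
  0 < r -> phi Rd r < `|th| -> `|th| <= phi Rd r + kappa * Num.sqrt s * expR (- (beta * r)) ->
  (c%:E <= Pdet P B beta Rd s (r, th))%E.
Proof.
move=> kappa0 hc r0 pth thD; have [mE ->] := detection_event; have [mB B0 cB _] := hB.
have [p0 p1 _] := phi_spec Rd0 rR.
have rR' : 0 < r <= Rd by have /andP[_ ->] := rR; rewrite r0.
have sh : 0 < sinh (beta * r) by rewrite sinh_gt0 ?mulr_gt0.
have s_gt0 : 0 < s.
  rewrite lt_neqAle s0 andbT eq_sym; apply/eqP => s00.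
  by move: thD; rewrite s00 sqrtr0 mulr0 mul0r addr0 leNgt pth.
set T := s * k; have T0 : 0 < T by rewrite mulr_gt0// invr_gt0 exprn_gt0.
set tau := Num.sqrt T; have tau0 : 0 < tau by rewrite sqrtr_gt0.
have tauE : tau = Num.sqrt s / sinh (beta * r).
  by rewrite /tau /T sqrtrM// sqrtrV ?exprn_ge0 ?(ltW sh)// sqrtr_sqr gtr0_norm.
(* Since [sinh x <= expR x], the width [kappa * Num.sqrt s * expR (- (beta * r))] is at most [kappa]
   standard deviations of the angle at time [s]. *)
have thtau : `|th| - phi Rd r <= kappa * tau.
  rewrite lerBlDl; apply: le_trans thD _; rewrite lerD2l tauE -mulrA ler_pM2l//.
  rewrite ler_pM2l ?sqrtr_gt0// expRN lef_pV2 ?posrE ?expR_gt0//.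
  by apply: le_trans (sinh_upper _); have := sh; lra.
(* Multiplying by the sign of [th] reduces both sides of the target to one: on [A] the signed angle
   falls from the absolute value of [th] to at most [phi Rd r]. *)
pose e := if 0 <= th then 1 else -1 : R.
have e1 : e = 1 \/ e = -1 by rewrite /e; case: ifP; [left|right].
have eth : e * th = `|th|.
  rewrite /e; case: ifPn => h; first by rewrite mul1r ger0_norm.
  by rewrite mulN1r ler0_norm// ltW// ltNge.
pose A : set R := [set y | e * y <= - (kappa * tau)].
have mA : measurable A.
  have h : measurable_fun setT (fun y : R => e * y) by apply: measurable_funM.
  have := h measurableT [set` `]-oo, - (kappa * tau)]%R] (measurable_itv _); rewrite setTI.
  by congr measurable; apply/seteqP; split => y /=; rewrite in_itv.
have cA : (c%:E <= normal_prob 0 tau A)%E.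
  have kt0 : 0 < kappa * tau by rewrite mulr_gt0.
  have hcA a' := hc tau a' A tau0 mA.
  case: e1 => ee; [apply: (hcA (- ((kappa + 1) * tau)))|apply: (hcA (kappa * tau))].
  - by move=> y; rewrite /A/= in_itv/= ee => /andP[_]; rewrite mulrDl mul1r; lra.
  - move=> y /andP[]; rewrite ler_norml mulrDl mul1r; lra.
  - by move=> y; rewrite /A/= in_itv/= ee => /andP[+ _]; lra.
  - move=> y /andP[]; rewrite ler_norml mulrDl mul1r; lra.
have := BM_increment hB (lexx 0) T0 mA; rewrite subr0 -/tau => PA.
rewrite -PA in cA; apply: le_trans cA _; apply: le_measure; rewrite ?inE//.
  have h : measurable_fun setT (fun w => B T w - B 0 w) by apply: measurable_funB.
  by have := h measurableT A mA; rewrite setTI.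
move=> w /=; rewrite B0 subr0 /A/= => hw.
pose f t := e * (th + B (t * k) w).
have cf : {within [set` `[0%R, s]%R], continuous f}.
  have cg : continuous (fun b => e * (th + b)).
    move=> b; apply: cvgM; first exact: cvg_cst.
    by apply: cvgD; [exact: cvg_cst|exact: cvg_id].
  have cF := within_continuous_rescale k0 (cB w) cg.
  apply: continuous_subspaceW cF.
  by move=> t /=; rewrite !in_itv/= andbT => /andP[].
have f0 : f 0 = `|th| by rewrite /f mul0r B0 addr0.
have fs : f s <= phi Rd r by rewrite /f mulrDr eth -/T; lra.
have [|t] := IVT s0 cf (v := phi Rd r).
  rewrite f0 ge_min fs orbT/= le_max (ltW pth)//.
rewrite in_itv/= => ts ft; exists t => //; apply/(hball_phi _ Rd0 rR').
rewrite -ft /f; case: e1 => ->; first by rewrite mul1r.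
by rewrite mulN1r cosN.
Qed.

End Detection.

(** * Comparison at a fixed radius *)

Section Slices.
Context {R : realType}.

Lemma integral_cst_itv (i : interval R) (x y m : R) : x < y ->
  i = `[x, y]%R \/ i = `]x, y]%R ->
  (\int[lebesgue_measure]_(t in [set` i]) m%:E = (m * (y - x))%:E)%E.
Proof.
move=> xy hi; rewrite integral_cst//= lebesgue_measure_itv.
by case: hi => ->; rewrite /= lte_fin xy.
Qed.

Lemma slice_lower (D : set (R * R)) (r m b : R) : 0 <= m -> 0 < b -> b < pi ->
  (forall t, `|t| <= b -> D (r, t)) ->
  ((m * (2 * b))%:E <=
   \int[lebesgue_measure]_(t in [set` `]- pi, pi]%R]) ((\1_D (r, t))%:E * m%:E))%E.
Proof.
move=> m0 b0 bpi hD.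
have -> : (m * (2 * b))%:E = (\int[lebesgue_measure]_(t in [set` `[- b, b]%R]) m%:E)%E.
  by rewrite (@integral_cst_itv _ (- b) b)//; [rewrite opprK mulr2n mulrDl mul1r|lra|left].
apply: le_integral_ge0.
- by move=> t _; rewrite lee_fin.
- by move=> t _; rewrite mule_ge0// lee_fin.
move=> t; rewrite /= !in_itv/= => tb _; split; first lra.
by rewrite indicE mem_set ?mul1e//; apply: hD; rewrite ler_norml.
Qed.

Section Comparison.
Context d (Omega : measurableType d) (P : probability Omega R).
Variable B : R -> Omega -> R.
Hypothesis hB : is_std_BM P B.
Variables (beta Rd s r m kappa : R).
Hypotheses (beta0 : 0 < beta) (Rd0 : 0 < Rd) (s0 : 0 <= s) (rR : 0 <= r <= Rd).
Hypotheses (kappa0 : 0 < kappa) (m0 : 0 <= m).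

Let D := Dset beta Rd s kappa.
Let Db := Dbar beta Rd s kappa.
(** The number [m] stands for the density of the measure at radius [r], which is constant in the
    angle. *)
Let f t := ((\1_Db (r, t))%:E * Pdet P B beta Rd s (r, t) * m%:E)%E.
Let g t := ((\1_D (r, t))%:E * m%:E)%E.
Let delta := kappa * Num.sqrt s * expR (- (beta * r)).

Let f0 t : (0 <= f t)%E.
Proof. by rewrite /f !mule_ge0 ?lee_fin// Pdet_ge0. Qed.

Let f_gt0 t : (0 < f t)%E -> Db (r, t).
Proof.
move=> ft; apply: contrapT => h; move: ft; rewrite /f indicE memNset//.
by rewrite !mul0e ltxx.
Qed.

Let f_le t : Db (r, t) -> f t = (Pdet P B beta Rd s (r, t) * m%:E)%E.
Proof. by move=> h; rewrite /f indicE mem_set// mul1e. Qed.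

Let Db_spec t : Db (r, t) -> - pi < t <= pi /\ phi Rd r + delta < `|t|.
Proof.
move=> [[/= _ tpi] nD]; split => //; rewrite ltNge; apply/negP => h.
by apply: nD; split.
Qed.

Let D_spec b t : b < pi -> b <= phi Rd r + delta -> `|t| <= b -> D (r, t).
Proof.
move=> bpi bphi tb; split; last exact: le_trans tb bphi.
by split => //=; move: tb; rewrite ler_norml; lra.
Qed.

Let delta0 : 0 <= delta.
Proof. by rewrite !mulr_ge0 ?sqrtr_ge0 ?expR_ge0// ltW. Qed.

(** Probabilities are at most 1, so the left side is at most [2 * pi * m], while the section of [D]
    contains an interval of width [2 * p0]. *)
Lemma slice_near_center (p0 : R) : 0 < p0 < pi -> p0 <= phi Rd r ->
  (\int[lebesgue_measure]_(t in [set` `]- pi, pi]%R]) f t <=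
   (pi / p0)%:E * \int[lebesgue_measure]_(t in [set` `]- pi, pi]%R]) g t)%E.
Proof.
move=> /andP[p00 p0pi] p0phi; have pi0 := pi_gt0 R.
apply: (@le_trans _ _ (m * (pi - - pi))%:E).
  rewrite -(@integral_cst_itv `]- pi, pi]%R); [|lra|by right].
  apply: le_integral_ge0 => [t _|t _|t tpi]; [exact: f0|by rewrite lee_fin|].
  move=> /f_gt0 hD; split => //; rewrite f_le// -[leRHS]mul1e.
  by apply: lee_wpmul2r; rewrite ?lee_fin// Pdet_le1.
apply: (@le_trans _ _ ((pi / p0)%:E * (m * (2 * p0))%:E)%E).
  rewrite -EFinM lee_fin le_eqVlt; apply/orP; left; apply/eqP.
  by field; rewrite gt_eqF.
rewrite lee_pmul2l ?lte_fin ?divr_gt0//.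
apply: slice_lower => // t; apply: D_spec => //.
by apply: le_trans p0phi _; rewrite lerDl.
Qed.

Let K := 256 * chaining_const R / kappa ^+ 4.

(** For [beta * r >= 1], [sinh (beta * r) >= expR (beta * r) / 4] gives
    [T <= 16 * delta ^+ 2 / kappa ^+ 2], whence the 256 in [K]. As [delta <= x] on this section, a
    factor [delta ^+ 2 / x ^+ 2] is then dropped from [delta ^+ 4 / x ^+ 4]. *)
Let f_bound t : 1 <= beta * r -> Db (r, t) ->
  (f t <= (m * K * delta ^+ 2 / (`|t| - phi Rd r) ^+ 2)%:E)%E.
Proof.
move=> br hD; have [tpi tphi] := Db_spec hD.
have r0 : 0 < r.
  by rewrite -(pmulr_rgt0 _ beta0); apply: lt_le_trans br.
have x0 : 0 < `|t| - phi Rd r by rewrite subr_gt0; apply: le_lt_trans tphi; rewrite lerDl.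
have xdelta : delta <= `|t| - phi Rd r by rewrite lerBrDl ltW.
have tpi' : `|t| <= pi by rewrite ler_norml; lra.
have hP := Pdet_upper hB beta0 Rd0 s0 rR r0 (_ : phi Rd r < `|t|) tpi'.
rewrite f_le//; apply: le_trans (lee_wpmul2r _ (hP _)) _.
- by rewrite lee_fin.
- by rewrite -subr_gt0.
rewrite -EFinM lee_fin mulrC /K.
set x := `|t| - phi Rd r in x0 xdelta *.
have eb := expR_gt0 (beta * r); have sl := sinh_lower br.
have sh : 0 < sinh (beta * r) by apply: lt_le_trans sl; rewrite divr_gt0.
set T := s / sinh (beta * r) ^+ 2.
have T0 : 0 <= T by rewrite divr_ge0 ?exprn_ge0// ltW.
have Td : T <= 16 * delta ^+ 2 / kappa ^+ 2.
  have -> : 16 * delta ^+ 2 / kappa ^+ 2 = s / (expR (beta * r) / 4) ^+ 2.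
    rewrite /delta expRN !exprMn sqr_sqrtr//.
    by field; rewrite !gt_eqF.
  have e4 : 0 < expR (beta * r) / 4 by rewrite divr_gt0.
  apply: ler_wpM2l => //; rewrite lef_pV2 ?posrE; [|exact: exprn_gt0|exact: exprn_gt0].
  by rewrite ler_sqr ?nnegrE ?(ltW e4) ?(ltW sh).
have C0 := chaining_const_gt0 R.
have key : T ^+ 2 / x ^+ 4 <= 256 / kappa ^+ 4 * (delta ^+ 2 / x ^+ 2).
  rewrite ler_pdivrMr ?exprn_gt0//.
  have -> : 256 / kappa ^+ 4 * (delta ^+ 2 / x ^+ 2) * x ^+ 4 =
      (16 / kappa ^+ 2) ^+ 2 * delta ^+ 2 * x ^+ 2 by field; rewrite !gt_eqF.
  apply: (@le_trans _ _ ((16 * delta ^+ 2 / kappa ^+ 2) ^+ 2)).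
    by rewrite ler_sqr ?nnegrE// (le_trans T0).
  have -> : (16 * delta ^+ 2 / kappa ^+ 2) ^+ 2 =
      (16 / kappa ^+ 2) ^+ 2 * delta ^+ 2 * delta ^+ 2 by field; rewrite gt_eqF.
  apply: ler_wpM2l; first by apply: mulr_ge0; exact: sqr_ge0.
  by rewrite ler_sqr ?nnegrE// ltW.
apply: (@le_trans _ _ (m * (chaining_const R * (256 / kappa ^+ 4 * (delta ^+ 2 / x ^+ 2))))).
  by rewrite ler_wpM2l// ler_wpM2l// ltW.
by rewrite le_eqVlt; apply/orP; left; apply/eqP; ring.
Qed.

Lemma slice_far : 1 <= beta * r ->
  (\int[lebesgue_measure]_(t in [set` `]- pi, pi]%R]) f t <=
   K%:E * \int[lebesgue_measure]_(t in [set` `]- pi, pi]%R]) g t)%E.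
Proof.
move=> br; have K0 : 0 < K.
  by rewrite divr_gt0 ?exprn_gt0// mulr_gt0// chaining_const_gt0.
have [p0 p1 _] := phi_spec Rd0 rR; have pi0 := pi_gt0 R.
have g0 t : (0 <= g t)%E by rewrite mule_ge0 ?lee_fin.
set a := phi Rd r + delta.
have vanish : (forall t, Db (r, t) -> (f t <= 0)%E) ->
  (\int[lebesgue_measure]_(t in [set` `]- pi, pi]%R]) f t <=
   K%:E * \int[lebesgue_measure]_(t in [set` `]- pi, pi]%R]) g t)%E.
  move=> h; apply: (@le_trans _ _ (\int[lebesgue_measure]_(t in set0) f t)%E).
    apply: le_integral_ge0 => // t _ ft; have := h t (f_gt0 ft).
    by rewrite leNgt ft.
  rewrite integral_set0 mule_ge0 ?lee_fin ?(ltW K0)//.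
  by apply: integral_ge0 => t _; exact: g0.
(* If [a >= pi], the section of [Dset] is the whole circle and that of [Dbar] is empty. *)
have [api|api] := leP pi a.
  apply: vanish => t /Db_spec[tpi]; rewrite ltNge => /negP[].
  by apply: le_trans api; rewrite ler_norml; lra.
have [d0|dn] := eqVneq delta 0.
  apply: vanish => t hD; apply: le_trans (f_bound br hD) _.
  by rewrite d0 expr0n/= mulr0 mul0r.
have d0 : 0 < delta by rewrite lt_neqAle eq_sym dn.
set c := m * K * delta ^+ 2.
have c0 : 0 <= c by apply: mulr_ge0; [apply: mulr_ge0 => //; exact: ltW|exact: sqr_ge0].
have pa : phi Rd r < a by rewrite ltrDl.
apply: (@le_trans _ _ (\int[lebesgue_measure]_(t in [set` `[a, pi]%R] `|` [set` `[- pi, - a]%R])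
     (c / (`|t| - phi Rd r) ^+ 2)%:E)%E).
  apply: le_integral_ge0 => //.
    by move=> t _; rewrite lee_fin divr_ge0// exprn_even_ge0.
  move=> t _ /f_gt0 hD; split; last exact: f_bound.
  have [tpi ta] := Db_spec hD; rewrite /= !in_itv/=.
  have [t0|t0] := leP 0 t; [left|right].
    by rewrite ger0_norm// in ta; apply/andP; split; [exact: ltW|lra].
  by rewrite ltr0_norm// in ta; rewrite -/a in ta; apply/andP; split; lra.
apply: le_trans (integral_inv_square_tails c0 (ltW p0) pa api) _.
have -> : a - phi Rd r = delta by rewrite /a addrAC subrr add0r.
apply: (@le_trans _ _ (K%:E * (m * (2 * a))%:E)%E); last first.
  rewrite lee_pmul2l ?lte_fin//; apply: slice_lower => //.
    by rewrite (lt_trans p0).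
  by move=> t; exact: D_spec.
rewrite -EFinM lee_fin.
(* The tails integrate to a multiple of [delta], and [delta <= a], the half-width of the section of
   [D]. *)
have -> : 2 * (c / delta) = K * (m * (2 * delta)) by rewrite /c; field; rewrite gt_eqF.
rewrite ler_wpM2l ?(ltW K0)// ler_wpM2l// ler_wpM2l// lerDr ltW//.
Qed.

End Comparison.
End Slices.

(** * Bounds uniform in the radius and integration over the disk *)

Lemma Phi_le1 (R : realType) (x : R) : Phi x <= 1.
Proof.
have mA : measurable `]-oo, x]%classic by exact: measurable_itv.
have f : normal_prob 0 1 `]-oo, x] \is a fin_num by exact: fin_num_measure.
by rewrite -lee_fin /Phi fineK// probability_le1.
Qed.

Lemma mu_dens_ge0 (R : realType) (nu alpha : R) (n : nat) (r : R) :
  0 <= alpha -> 0 <= r -> 0 <= mu_dens nu alpha n r.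
Proof.
move=> a0 r0; rewrite /mu_dens divr_ge0//.
  by do 2! apply: mulr_ge0 => //; rewrite sinh_ge0// mulr_ge0.
by apply: mulr_ge0; [rewrite mulr_ge0// pi_ge0|rewrite subr_ge0 cosh_ge1].
Qed.

(** A point of [Dset] is the centre, or starts inside the ball, or lies in the strip outside it. The
    first two are detected with probability 1, hence the minimum with 1. *)
Lemma Pdet_Dset_lower (R : realType) (beta kappa : R) : 0 < beta -> 0 < kappa ->
  exists2 c : R, 0 < c <= 1 &
  forall d (Omega : measurableType d) (P : probability Omega R) (B : R -> Omega -> R)
    (Rd s : R) x0, is_std_BM P B -> 0 < Rd -> 0 <= s ->
    Dset beta Rd s kappa x0 -> (c%:E <= Pdet P B beta Rd s x0)%E.
Proof.
move=> beta0 kappa0; have [c c0 hc] := normal_prob_lower (kappa + 1).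
exists (Num.min c 1); first by rewrite lt_min c0 ltr01/= ge_min lexx orbT.
move=> d Omega P B Rd s [r th] hB Rd0 s0 [[/= rR thpi] thD].
have start : hball (Rd, 0) Rd (r, th) -> ((Num.min c 1)%:E <= Pdet P B beta Rd s (r, th))%E.
  move=> /(Pdet_start hB beta Rd0 s0 rR) ->.
  by rewrite lee_fin ge_min lexx orbT.
have /andP[r0 _] := rR.
move: r0; rewrite le_eqVlt => /predU1P[r0|r0].
  by apply: start; rewrite -r0; exact: hball_center.
have rR' : 0 < r <= Rd by have /andP[_ ->] := rR; rewrite r0.
have [p0 p1 _] := phi_spec Rd0 rR.
have [thp|thp] := leP `|th| (phi Rd r).
  apply: start; apply/(hball_phi _ Rd0 rR'); rewrite leNgt.
  have -> : cos th = cos `|th|.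
    by have [h|h] := leP 0 th; [rewrite ger0_norm|rewrite ltr0_norm// cosN].
  by rewrite ltr_cos ?in_itv/= ?normr_ge0 ?p1 ?(ltW p0)// -?leNgt// (le_trans thp).
apply: le_trans (Pdet_lower hB beta0 Rd0 s0 rR kappa0 hc r0 thp thD).
by rewrite lee_fin ge_min lexx.
Qed.

Lemma slice_comparison (R : realType) (beta kappa : R) : 0 < beta -> 0 < kappa ->
  exists2 C : R, 0 < C &
  forall d (Omega : measurableType d) (P : probability Omega R) (B : R -> Omega -> R)
    (Rd s r m : R), is_std_BM P B -> 1 / beta <= Rd -> 0 <= s -> 0 <= m -> 0 <= r <= Rd ->
  (\int[lebesgue_measure]_(t in [set` `]- pi, pi]%R])
     ((\1_(Dbar beta Rd s kappa) (r, t))%:E * Pdet P B beta Rd s (r, t) * m%:E) <=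
   C%:E * \int[lebesgue_measure]_(t in [set` `]- pi, pi]%R])
     ((\1_(Dset beta Rd s kappa) (r, t))%:E * m%:E))%E.
Proof.
move=> beta0 kappa0; have rho0 : 0 < 1 / beta by rewrite divr_gt0.
have [p0 p0pi hp0] := phi_lower rho0.
set K := 256 * chaining_const R / kappa ^+ 4.
have K0 : 0 < K by rewrite divr_gt0 ?exprn_gt0// mulr_gt0// chaining_const_gt0.
have K'0 : 0 < pi / p0 by case/andP: p0pi => p00 _; rewrite divr_gt0 ?pi_gt0.
exists (pi / p0 + K); first by rewrite addr_gt0.
move=> d Omega P B Rd s r m hB rhoR s0 m0 rR.
have Rd0 := lt_le_trans rho0 rhoR.
have I0 : (0 <= \int[lebesgue_measure]_(t in [set` `]- pi, pi]%R])
     ((\1_(Dset beta Rd s kappa) (r, t))%:E * m%:E))%E.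
  by apply: integral_ge0 => t _; rewrite mule_ge0 ?lee_fin.
have /andP[r0 _] := rR.
have [rrho|rrho] := leP r (1 / beta).
  apply: le_trans (slice_near_center hB beta Rd0 s0 rR kappa0 m0 p0pi _) _.
    by apply: hp0; rewrite // r0.
  by apply: lee_wpmul2r => //; rewrite lee_fin lerDl ltW.
apply: le_trans (slice_far hB beta0 Rd0 s0 rR kappa0 m0 _) _.
  by rewrite mulrC -ler_pdivrMr// ltW.
by apply: lee_wpmul2r => //; rewrite lee_fin lerDr ltW.
Qed.
Unset Implicit Arguments.

Theorem mainTheorem4 (R : realType) (nu alpha beta kappa : R)
  (hnu : 0 < nu) (halpha1 : 1 / 2 < alpha) (halpha2 : alpha <= 1)
  (hbeta : 0 < beta) (hkappa : 0 < kappa)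
  (s : nat -> R) (hs : forall n, 0 <= s n) :
  exists (c C1 C2 : R) (N : nat), 0 < c /\ 0 < C1 /\ 0 < C2 /\
  forall n : nat, (N <= n)%N ->
    kappa * Num.sqrt (s n) <= (pi - phi (Rad nu n) (Rad nu n)) * sinh (beta * Rad nu n) ->
    forall (d : measure_display) (Omega : measurableType d)
           (P : probability Omega R) (B : R -> Omega -> R),
    is_std_BM P B ->
    [/\ forall x0, Dset beta (Rad nu n) (s n) kappa x0 ->
          ((c * Phi (- kappa))%:E <= Pdet P B beta (Rad nu n) (s n) x0)%E,
        forall x0, Dbar beta (Rad nu n) (s n) kappa x0 ->
          (Pdet P B beta (Rad nu n) (s n) x0 <= (C1 * Phi (- kappa))%:E)%E &
        (mu_int nu alpha n
           (fun x => (\1_(Dbar beta (Rad nu n) (s n) kappa) x)%:E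
                     * Pdet P B beta (Rad nu n) (s n) x)
         <= C2%:E * mu_int nu alpha n
                      (fun x => (\1_(Dset beta (Rad nu n) (s n) kappa) x)%:E))%E].
Proof.
have [c /andP[c0 c1] hc] := Pdet_Dset_lower hbeta hkappa.
have [C C0 hC] := slice_comparison hbeta hkappa.
have [N hN] := Rad_eventually (1 / beta) hnu.
have F0 := Phi_gt0 (- kappa).
(* Since [kappa] is fixed, [Phi (- kappa)] is a positive constant: the bound 1 on probabilities
   gives the supremum estimate with its inverse. [N] ensures [1 / beta <= Rad nu n]. *)
exists c, (Phi (- kappa))^-1, C, N; split; first exact: c0.
split; first by rewrite invr_gt0.
split; first exact: C0.
move=> n Nn _ d Omega P B hB; have rhoR := hN n Nn.
have Rd0 : 0 < Rad nu n by apply: lt_le_trans rhoR; rewrite divr_gt0.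
have alpha0 : 0 <= alpha by lra.
split.
- move=> x0 Dx0; apply: (@le_trans _ _ c%:E).
    by rewrite lee_fin ler_piMr ?(ltW c0) ?Phi_le1.
  exact: hc.
- move=> [r th] [[/= rR _] _]; rewrite mulVf ?gt_eqF//.
  exact: Pdet_le1.
- rewrite /mu_int.
  apply: (@le_trans _ _ (\int[lebesgue_measure]_(r in [set` `[0%R, Rad nu n]%R])
    (C%:E * \int[lebesgue_measure]_(th in [set` `]- pi, pi]%R])
        ((\1_(Dset beta (Rad nu n) (s n) kappa) (r, th))%:E * (mu_dens nu alpha n r)%:E)))%E).
    have m0 r : [set` `[0%R, Rad nu n]%R] r -> 0 <= mu_dens nu alpha n r.
      by rewrite /= in_itv/= => /andP[r0 _]; exact: mu_dens_ge0.
    apply: le_integral_ge0 => [r rR|r rR|r rR _].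
    + apply: integral_ge0 => t _; rewrite !mule_ge0 ?lee_fin ?m0//; exact: measure_ge0.
    + rewrite mule_ge0 ?lee_fin ?(ltW C0)//.
      by apply: integral_ge0 => t _; rewrite mule_ge0 ?lee_fin ?m0.
    + by split => //; apply: hC => //; exact: m0.
  apply: integral_scale_le => // r; rewrite /= in_itv/= => /andP[r0 _].
  by apply: integral_ge0 => t _; rewrite mule_ge0 ?lee_fin ?mu_dens_ge0.
Qed.
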